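(* Let $I$ be a translation invariant analytic P-ideal of subsets of $\mathbb N$, and let $\vec a$ be a base sequence adapted to $I$. Then $I[\vec a]$ is a Polish $\mathbb Q_{\vec a}$-module, and the identity map $I[\vec a]\to\mathbb R$ is a continuous $\mathbb Q_{\vec a}$-embedding.
   Context: $\mathbb N=\{1,2,\dots\}$; subsets of $\mathbb N$ are identified with $2^{\mathbb N}$ (product topology). A base sequence is $\vec a=(a_n)$ with $a_n\in\mathbb N$, $a_n\ge2$. Every $r\in\mathbb R_{\ge0}$ has a unique representation $r=[r]+\sum_{n\ge1}\frac{r_n}{a_1\cdots a_n}$ ($[r]$ the integer part, $0\le r_n<a_n$ integers, $r_n\ne a_n-1$ for infinitely many $n$); $j_{\vec a}(r)=\{n: r_n\ne r_{n+1}\}$. An ideal is a nonempty family of subsets of $\mathbb N$ closed under finite unions and subsets and containing all singletons. $I$ is translation invariant if $x\in I$ implies $\{n+1:n\in x\}\in I$ and $\{n:n+1\in x\}\in I$. $\vec a$ is adapted to $I$ if $\{n:a_n\ne a_{n+1}\}\in I$. An lsc submeasure is a lower semicontinuous, monotone, subadditive $\phi:2^{\mathbb N}\to[0,\infty]$ with $0<\phi(\{n\})<\infty$ for all $n$; $\mathrm{Exh}(\phi)=\{x: \phi(x\setminus\{1,\dots,n\})\to0\}$. An analytic P-ideal is an ideal analytic in $2^{\mathbb N}$ such that for every sequence $(x_n)$ in $I$ some $y\in I$ has $x_n\setminus y$ finite for all $n$; equivalently $I=\mathrm{Exh}(\phi)$ for some lsc submeasure $\phi$. $\mathrm{pr}(\vec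 a)$ is the set of primes dividing $a_n$ for all but finitely many $n$; $\mathbb Q_{\vec a}=\{k/l: k\in\mathbb Z,l\in\mathbb N,\text{ all prime divisors of }l\text{ in }\mathrm{pr}(\vec a)\}$. The module $I[\vec a]$: its underlying set is $H=\{\pm r: r\in\mathbb R_{\ge0}, j_{\vec a}(r)\in I\}$, with addition and multiplication by elements of $\mathbb Q_{\vec a}$ inherited from $\mathbb R$; its topology (the submeasure topology) is defined by fixing an lsc submeasure $\phi$ with $I=\mathrm{Exh}(\phi)$, setting $\rho(r,s)=\phi(j_{\vec a}(|r-s|))+|r-s|$, and declaring $U\subseteq H$ open iff for every $r\in U$ there is $\epsilon>0$ with $\{s\in H:\rho(r,s)<\epsilon\}\subseteq U$ (this topology does not depend on the choice of $\phi$). A Polish $R$-module (for a countable commutative ring $R$) is an abelian Polish group $M$ with an action $R\times M\to M$ continuous for discrete $R$ satisfying the module axioms; a $\mathbb Q_{\vec a}$-embedding is an injective $\mathbb Q_{\vec a}$-module homomorphism. *)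

(* Defs.v *)
From HB Require Import structures.
From mathcomp Require Import all_boot all_order all_algebra.
From mathcomp Require Import all_classical all_reals all_analysis.

Set Implicit Arguments.
Unset Strict Implicit.
Unset Printing Implicit Defensive.

Import Order.TTheory GRing.Theory Num.Theory.
Import numFieldNormedType.Exports.

Local Open Scope classical_set_scope.
Local Open Scope ring_scope.

(** Convention: the index set {1, 2, ...} of the mathematics is encoded by
    [nat], the element n : nat standing for the index n + 1.  Hence the base
    sequence a_1, a_2, ... is [a 0, a 1, ...], a subset of {1, 2, ...} is a
    [set nat], and {1, ..., n} is [`I_n]. *)

Record complete_metric_for (R : realType) (T : topologicalType)
    (d : T -> T -> R) : Prop := CompleteMetricFor {
  complete_metric_eq0 : forall x y, d x y = 0 <-> x = y;
  complete_metric_sym : forall x y, d x y = d y x;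
  complete_metric_triangle : forall x y z, d x z <= d x y + d y z;
  complete_metric_nbhs : forall (x : T) (A : set T),
    nbhs x A <-> exists2 e : R, 0 < e & [set y | d x y < e] `<=` A;
  complete_metric_complete : forall u : nat -> T,
    (forall e : R, 0 < e -> exists N, forall m n,
      (N <= m)%N -> (N <= n)%N -> d (u m) (u n) < e) ->
    exists l : T, u @ \oo --> l
}.

Definition polish_space (R : realType) (T : topologicalType) : Prop :=
  (exists2 D : set T, countable D & dense D) /\
  (exists d : T -> T -> R, complete_metric_for d).

(* The empty set is covered: [Y] may be empty. *)
Definition analytic_set (R : realType) (T : topologicalType) (A : set T) :
    Prop :=
  exists (Y : topologicalType) (f : Y -> T),
    [/\ polish_space R Y, continuous f & range f = A].

(* Topological notions on sets of subsets of N are read through this bijection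
   from 2^N, which carries the product topology. *)
Definition subset_of (x : cantor_space) : set nat := [set n | x n].

Record ideal (I : set (set nat)) : Prop := Ideal {
  ideal_nonempty : I !=set0;
  ideal_setU : forall x y, I x -> I y -> I (x `|` y);
  ideal_sub : forall x y, x `<=` y -> I y -> I x;
  ideal_set1 : forall n : nat, I [set n]
}.

Definition P_property (I : set (set nat)) : Prop :=
  forall x : nat -> set nat, (forall n, I (x n)) ->
    exists2 y, I y & forall n, finite_set (x n `\` y).

Definition analytic_P_ideal (R : realType) (I : set (set nat)) : Prop :=
  [/\ ideal I, analytic_set R (subset_of @^-1` I) & P_property I].

Definition translation_invariant (I : set (set nat)) : Prop :=
  forall x, I x -> I (succn @` x) /\ I (succn @^-1` x).

(* [phi set0 = 0] is not required; it holds as soon as [Exh phi] is nonempty. *)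
Record lsc_submeasure (R : realType) (phi : set nat -> \bar R) : Prop :=
  LscSubmeasure {
  submeasure_ge0 : forall x, (0 <= phi x)%E;
  submeasure_mono : forall x y, x `<=` y -> (phi x <= phi y)%E;
  submeasure_setU : forall x y, (phi (x `|` y) <= phi x + phi y)%E;
  submeasure_lsc : lower_semicontinuous (phi \o subset_of);
  submeasure_set1 : forall n : nat, (0 < phi [set n] < +oo)%E
}.

Definition Exh (R : realType) (phi : set nat -> \bar R) : set (set nat) :=
  [set x | phi (x `\` `I_n) @[n --> \oo] --> 0%E].

Definition base_sequence (a : nat -> nat) : Prop := forall n, (2 <= a n)%N.

Definition adapted (a : nat -> nat) (I : set (set nat)) : Prop :=
  I [set n | a n <> a n.+1].

Record expansion (R : realType) (a : nat -> nat) (r : R) (d : nat -> nat) :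
    Prop := Expansion {
  expansion_lt : forall n, (d n < a n)%N;
  expansion_inf : forall m, exists2 n, (m <= n)%N & d n <> (a n).-1;
  expansion_cvg :
    (\sum_(0 <= k < n) (d k)%:R / \prod_(i < k.+1) (a i)%:R) @[n --> \oo]
      --> r - (Num.floor r)%:~R
}.

(* For a base sequence and r >= 0 the expansion exists and is unique; [xget]
   selects it, and its default value is then irrelevant. *)
Definition digits (R : realType) (a : nat -> nat) (r : R) : nat -> nat :=
  xget (fun=> 0%N) [set d | expansion a r d].

Definition jset (R : realType) (a : nat -> nat) (r : R) : set nat :=
  [set n | digits a r n <> digits a r n.+1].

Definition pr (a : nat -> nat) : set nat :=
  [set p | prime p /\ \forall n \near \oo, (p %| a n)%N].

Definition Qa_pred (a : nat -> nat) : {pred rat} :=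
  fun q => `[< exists (k : int) (l : nat),
    [/\ (0 < l)%N, forall p, prime p -> (p %| l)%N -> pr a p
      & q = k%:~R / l%:R] >].

Lemma Qa_predP (a : nat -> nat) (q : rat) :
  reflect (exists (k : int) (l : nat),
    [/\ (0 < l)%N, forall p, prime p -> (p %| l)%N -> pr a p
      & q = k%:~R / l%:R]) (q \in Qa_pred a).
Proof. exact: asboolP. Qed.

Lemma Qa_subring_closed (a : nat -> nat) : subring_closed (Qa_pred a).
Proof.
have den_neq0 (l : nat) : (0 < l)%N -> l%:R != 0 :> rat.
  by move=> l0; rewrite pnatr_eq0 -lt0n.
have prM (l l' : nat) : (forall p, prime p -> (p %| l)%N -> pr a p) ->
    (forall p, prime p -> (p %| l')%N -> pr a p) ->
    forall p, prime p -> (p %| l * l')%N -> pr a p.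
  by move=> h h' p pp; rewrite Euclid_dvdM// => /orP[]; [exact: h|exact: h'].
split.
- apply/Qa_predP; exists 1, 1%N; split => //.
  by move=> p pp; rewrite dvdn1 => /eqP p1; rewrite p1 in pp.
- move=> _ _ /Qa_predP[k [l [l0 hl ->]]] /Qa_predP[k' [l' [l'0 hl' ->]]].
  apply/Qa_predP; exists (k * l' - k' * l), (l * l')%N; split.
  + by rewrite muln_gt0 l0.
  + exact: prM.
  + rewrite -mulNr addf_div ?den_neq0// natrM; congr (_ / _).
    by rewrite mulNr rmorphB !rmorphM.
- move=> _ _ /Qa_predP[k [l [l0 hl ->]]] /Qa_predP[k' [l' [l'0 hl' ->]]].
  apply/Qa_predP; exists (k * k'), (l * l')%N; split.
  + by rewrite muln_gt0 l0.
  + exact: prM.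
  + by rewrite mulf_div natrM rmorphM.
Qed.

HB.instance Definition _ (a : nat -> nat) :=
  GRing.isSubringClosed.Build rat (Qa_pred a) (Qa_subring_closed a).

Record Qa (a : nat -> nat) := MkQa { Qa_val : rat; Qa_valP : Qa_val \in Qa_pred a }.

HB.instance Definition _ (a : nat -> nat) := [isSub for @Qa_val a].
HB.instance Definition _ (a : nat -> nat) := [Countable of Qa a by <:].
HB.instance Definition _ (a : nat -> nat) :=
  [SubChoice_isSubComNzRing of Qa a by <:].

(* The continuity of the addition and of the opposite is part of
   [topologicalZmodType].  As the ring [K] is discrete, the action is jointly
   continuous iff each scaling is continuous. *)
Record polish_module (R : realType) (K : countComNzRingType)
    (M : topologicalZmodType) (act : K -> M -> M) : Prop := PolishModule {
  polish_module_space : polish_space R M;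
  polish_module_act_continuous : forall k, continuous (act k);
  polish_module_actA : forall k l x, act k (act l x) = act (k * l) x;
  polish_module_act1 : left_id 1 act;
  polish_module_actDr : right_distributive act +%R;
  polish_module_actDl : forall x, {morph act^~ x : k l / k + l}
}.

Record module_hom (K : Type) (M N : zmodType) (actM : K -> M -> M)
    (actN : K -> N -> N) (f : M -> N) : Prop := ModuleHom {
  module_hom_add : forall x y, f (x + y) = f x + f y;
  module_hom_act : forall k x, f (actM k x) = actN k (f x)
}.

Definition module_embedding (K : Type) (M N : zmodType) (actM : K -> M -> M)
    (actN : K -> N -> N) (f : M -> N) : Prop :=
  injective f /\ module_hom actM actN f.

Definition real_act (R : realType) (a : nat -> nat) (q : Qa a) (x : R) : R :=
  ratr (Qa_val q) * x.

Section IdealModule.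
Variables (R : realType) (I : set (set nat)) (a : nat -> nat).
Variable phi : set nat -> \bar R.

Definition carrier : set R :=
  [set x | exists r : R, [/\ 0 <= r, I (jset a r) & x = r \/ x = - r]].

Definition rho (r s : R) : \bar R := (phi (jset a `|r - s|%R) + (`|r - s|%R)%:E)%E.

Definition submeasure_open (U : set R) : Prop :=
  U `<=` carrier /\
  forall r, U r -> exists2 e : R, 0 < e &
    [set s | carrier s /\ (rho r s < e%:E)%E] `<=` U.

(* [M], with action [act] and inclusion map [iota], is I[a]: its underlying set
   is [carrier], its operations are those of the reals, and its topology is the
   submeasure topology given by [phi].  Up to renaming of elements there is at
   most one such [M]; that there is one says in particular that [carrier] is
   closed under the operations. *)
Record is_ideal_module (M : topologicalZmodType) (act : Qa a -> M -> M)
    (iota : M -> R) : Prop := IsIdealModule {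
  ideal_module_inj : injective iota;
  ideal_module_range : range iota = carrier;
  ideal_module_hom : module_hom act (@real_act R a) iota;
  ideal_module_open : forall U : set M, open U <-> submeasure_open (iota @` U)
}.

End IdealModule.

(* Main.v *)
Require Import Defs.
From HB Require Import structures.
From mathcomp Require Import all_boot all_order all_algebra.
From mathcomp Require Import all_classical all_reals all_analysis.
From mathcomp Require Import zify ring lra.

Set Implicit Arguments.
Unset Strict Implicit.
Unset Printing Implicit Defensive.

Import Order.TTheory GRing.Theory Num.Theory.
Import numFieldNormedType.Exports.

Local Open Scope classical_set_scope.
Local Open Scope ring_scope.

(** For a real [x] of either sign put [D_n(x) = floor(P_{n+1} x) - a_n floor(P_n x)]
    with [P_n = a_0 ... a_(n-1)]; for [x >= 0] these are the digits.  Let [J(x)] be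
    the set of their jumps and [A] that of the jumps of [a].  The borrow in [x - y]
    can change only where one of [x], [y], [a] jumps, whence
    [J(x - y) <= B u (B - 1)] for [B = J(x) u J(y) u A]; similarly
    [J(x / p) <= F u B u (B + 1)] with [B = J(x) u A] and [F] finite, when [p]
    divides almost all [a_n].

    Translation invariance makes both shifts continuous at the empty set for [phi],
    so the sets [{x | phi(J(x) - A) < e, |x| < e}] are a base at 0 of a group
    topology, which is the submeasure topology since small nonnegative [x] have no
    early jumps.  The group is metrizable because the base is countable.  It is
    complete because [J] is continuous from the right and [phi] is lower
    semicontinuous: of a Cauchy sequence tending to [x] in [R], infinitely many terms
    lie on one side of [x], and one argues with [u_m - u_n] or [u_n - u_m]
    accordingly.  It is separable because two elements with the same integer part of
    [P_n x] and few jumps beyond [n] are close. *)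

(** * Digits *)

Section Digits.
Variables (R : realType) (a : nat -> nat).
Implicit Types (x y : R) (n k : nat).

Definition base_prod n : nat := \prod_(i < n) a i.

Definition scaled_floor x n : int := Num.floor ((base_prod n)%:R * x).

(* Defined for negative [x] as well, where it is not the digit of [- x]. *)
Definition digit x n : int := scaled_floor x n.+1 - (a n)%:Z * scaled_floor x n.

Definition jumps x : set nat := [set n | digit x n <> digit x n.+1].

Definition base_jumps : set nat := [set n | a n <> a n.+1].

Definition lookahead (B : set nat) : set nat := B `|` succn @^-1` B.

Lemma lookahead_mono (B C : set nat) : B `<=` C -> lookahead B `<=` lookahead C.
Proof. by move=> BC n [/BC|/BC]; [left|right]. Qed.

Lemma base_prodS n : base_prod n.+1 = (base_prod n * a n)%N.
Proof. by rewrite /base_prod big_ord_recr. Qed.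

Lemma floor_mul_bounds (m : nat) (u : R) : (0 < m)%N ->
  0 <= Num.floor (m%:R * u) - m%:Z * Num.floor u < m%:Z.
Proof.
move=> m0; have m0R : 0 < m%:R :> R by rewrite ltr0n.
have /andP[fu uf] := floor_itv u.
have /andP[fm mf] := floor_itv (m%:R * u).
apply/andP; split.
  by rewrite subr_ge0 floor_ge_int intrM ler_wpM2l.
rewrite ltrBlDr -[ltRHS]/(m%:Z + _) floor_lt_int.
apply: (@lt_le_trans _ _ (m%:R * (Num.floor u + 1)%:~R)).
  by rewrite ltr_pM2l.
by rewrite !intrD intrM mulrDr mulr1 addrC.
Qed.

Lemma floor_sub_bounds (u v : R) :
  -1 <= Num.floor (u - v) - Num.floor u + Num.floor v <= 0.
Proof.
have /andP[fu uf] := floor_itv u.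
have /andP[fv vf] := floor_itv v.
have /andP[fw wf] := floor_itv (u - v).
rewrite !intrD in uf vf wf.
apply/andP; split.
- rewrite -ltzD1 -(ltr_int R) !intrD intrN; lra.
- rewrite -ltzD1 -(ltr_int R) !intrD intrN; lra.
Qed.

Hypothesis a_ge2 : base_sequence a.

Let a_gt0 n : (0 < a n)%N. Proof. exact: leq_trans (a_ge2 n). Qed.

Lemma base_prod_gt0 n : (0 < base_prod n)%N.
Proof. by rewrite prodn_gt0. Qed.

Lemma base_prodR_gt0 n : 0 < (base_prod n)%:R :> R.
Proof. by rewrite ltr0n base_prod_gt0. Qed.

Lemma ltn_base_prod n : (n < base_prod n)%N.
Proof.
elim: n => [|n IH]; first by rewrite base_prod_gt0.
by rewrite base_prodS; have := a_ge2 n; nia.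
Qed.

Lemma leq_base_prod k n : (k <= n)%N -> (base_prod k <= base_prod n)%N.
Proof.
move=> /subnK <-; elim: (n - k)%N => // m IH.
by rewrite addSn base_prodS (leq_trans IH)// leq_pmulr.
Qed.

Lemma base_prod_small (e : R) : 0 < e -> exists n, forall x k, (n <= k)%N ->
  `|x| * (base_prod k)%:R < 1 -> `|x| < e.
Proof.
move=> e0; exists (Num.bound e^-1) => x k nk xk.
have ek : e^-1 < (base_prod k)%:R.
  apply: lt_le_trans (archi_boundP (ltW _)) _; first by rewrite invr_gt0.
  by rewrite ler_nat (leq_trans _ (leq_base_prod nk))// ltnW// ltn_base_prod.
rewrite -(ltr_pM2r (base_prodR_gt0 k)) (lt_trans xk)//.
by rewrite mulrC -ltr_pdivrMr// mul1r.
Qed.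

Lemma digit_bounds x n : 0 <= digit x n < (a n)%:Z.
Proof.
by rewrite /digit /scaled_floor base_prodS mulnC natrM -mulrA floor_mul_bounds.
Qed.

(* The borrows [e n] of the subtraction [x - y] lie in [{-1, 0}], and
   [e n <> e n.+1] forces one of [digit x], [digit y], [a] to jump at [n]. *)
Lemma jumps_sub x y :
  jumps (x - y) `<=` lookahead (jumps x `|` jumps y `|` base_jumps).
Proof.
pose e n : int := scaled_floor (x - y) n - scaled_floor x n + scaled_floor y n.
have eP n : e n = 0 \/ e n = -1.
  have := floor_sub_bounds ((base_prod n)%:R * x) ((base_prod n)%:R * y).
  rewrite -mulrBr -!/(scaled_floor _ _) -/(e n).
  by move: (e n) => i; lia.
have dE n : digit (x - y) n =
    digit x n - digit y n + e n.+1 - (a n)%:Z * e n.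
  by rewrite /digit /e; ring.
have step n : ~ (jumps x `|` jumps y `|` base_jumps) n ->
  [/\ digit x n = digit x n.+1, digit y n = digit y n.+1, a n = a n.+1
    & e n = e n.+1].
  move=> nB.
  have dx : digit x n = digit x n.+1.
    by apply: contrapT => h; apply: nB; left; left.
  have dy : digit y n = digit y n.+1.
    by apply: contrapT => h; apply: nB; left; right.
  have an : a n = a n.+1 by apply: contrapT => h; apply: nB; right.
  split => //.
  have := digit_bounds (x - y) n; have := digit_bounds (x - y) n.+1.
  rewrite !dE -dx -dy -an.
  by case: (eP n) => ->; case: (eP n.+1) => ->; case: (eP n.+2) => ->; lia.
move=> n jn; apply: contrapT => /not_orP[nB nB1]; apply: jn.
have [dx dy an en] := step _ nB; have [_ _ _ en1] := step _ nB1.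
by rewrite !dE -dx -dy -an -en1 en.
Qed.

(** The remainder [r n.+1] of [scaled_floor x n.+1] modulo [p] is the residue of [digit x n] as soon
    as [p] divides [a n]. From there on, [p] times a digit of [x / p] is determined by two
    consecutive digits of [x] and one term of [a]. The reference to the previous digit is what
    brings in the forward shift of the jumps. *)
Lemma jumps_div (p N : nat) x : (0 < p)%N ->
  (forall n, (N <= n)%N -> (p %| a n)%N) ->
  jumps (x / p%:R) `<=`
    `I_N.+1 `|` ((jumps x `|` base_jumps) `|` succn @` (jumps x `|` base_jumps)).
Proof.
move=> p0 pa; pose f := scaled_floor (x / p%:R).
pose r n := scaled_floor x n - p%:Z * f n.
have rP n : 0 <= r n < p%:Z.
  rewrite /r /f /scaled_floor.
  suff -> : (base_prod n)%:R * x = p%:R * ((base_prod n)%:R * (x / p%:R)).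
    exact: floor_mul_bounds.
  by field; rewrite pnatr_eq0 -lt0n.
have dE n : digit x n =
    p%:Z * digit (x / p%:R) n + r n.+1 - (a n)%:Z * r n.
  by rewrite /digit /r /f; ring.
have rE n : (N <= n)%N -> r n.+1 = (digit x n %% p%:Z)%Z.
  move=> /pa /dvdnP[b ab]; rewrite dE ab PoszM.
  rewrite (_ : _ - _ = (digit (x / p%:R) n - b%:Z * r n) * p%:Z + r n.+1);
    last by ring.
  by rewrite modzMDl modz_small.
case=> [|n] jn; first by left.
apply: contrapT => /not_orP[nN /not_orP[nB nB1]]; apply: jn.
have {}nN : (N <= n)%N by rewrite leqNgt; apply/negP => nN'; apply: nN => /=; lia.
have B m : ~ (jumps x `|` base_jumps) m ->
    digit x m = digit x m.+1 /\ a m = a m.+1.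
  by move=> /not_orP[/contrapT ? /contrapT].
have [d1 a1] := B _ nB.
have [d0 a0] := B n (fun h => nB1 (ex_intro2 _ _ n h erefl)).
have r1 := rE n nN; have r2 := rE n.+1 (leqW nN).
have r3 := rE n.+2 (leqW (leqW nN)).
have := dE n.+1; have := dE n.+2; rewrite -d1 -a1.
rewrite r3 r2 r1 -d1 -d0 => e2 e1.
have : p%:Z * digit (x / p%:R) n.+1 = p%:Z * digit (x / p%:R) n.+2.
  by move: e1 e2; lia.
by apply: mulfI; rewrite eqz_nat -lt0n.
Qed.

(** All floors up to [n.+1] share one value [c], which is 0 or -1 according to the sign of [x]. The
    early digits are thus [c - a k * c]: zero, or the maximal digits [a k - 1], which jump exactly
    with [a]. *)
Lemma jumps_small x n : `|x| * (base_prod n.+1)%:R < 1 ->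
  jumps x `&` `I_n `<=` base_jumps.
Proof.
move=> xn.
have small k : (k <= n.+1)%N -> `|x * (base_prod k)%:R| < 1.
  move=> kn; rewrite normrM normr_nat (le_lt_trans _ xn)//.
  by rewrite ler_wpM2l// ler_nat leq_base_prod.
have [c cP] : exists c, forall k, (k <= n.+1)%N -> scaled_floor x k = c.
  have [x0|x0] := leP 0 x; [exists 0|exists (-1)] => k kn.
    apply: floor_def; move: (small k kn).
    by rewrite ltr_norml mulrC mulr_ge0//= add0r => /andP[].
  apply: floor_def; move: (small k kn); rewrite ltr_norml mulrC addNr.
  by move=> /andP[/ltW -> _] /=; rewrite pmulr_rlt0// base_prodR_gt0.
move=> k [jk /= kn] akk; apply: jk.
by rewrite /digit !cP ?akk//; lia.
Qed.

Lemma jumps_small_ge0 x n : 0 <= x -> x * (base_prod n.+1)%:R < 1 ->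
  jumps x `&` `I_n `<=` set0.
Proof.
move=> x0 xn.
have cP k : (k <= n.+1)%N -> scaled_floor x k = 0.
  move=> kn; apply: floor_def; rewrite mulrC mulr_ge0//= add0r (le_lt_trans _ xn)//.
  by rewrite ler_wpM2l// ler_nat leq_base_prod.
move=> k [jk /= kn]; apply: jk.
by rewrite /digit !cP ?mulr0//; lia.
Qed.

(** The floor function is locally constant to the right of each point, and jumps below [n] involve
    only the floors of index below [n.+2]. *)
Lemma jumps_right_continuous x n : exists2 e : R, 0 < e &
  forall y, x <= y < x + e -> forall k, (k < n)%N -> jumps y k <-> jumps x k.
Proof.
have [e e0 eP] : exists2 e : R, 0 < e & forall y, x <= y < x + e ->
    forall k, (k < n.+2)%N -> scaled_floor y k = scaled_floor x k.
  elim: (n.+2) => [|m [e e0 IH]]; first by exists 1.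
  have /andP[fx xf] := floor_itv ((base_prod m)%:R * x).
  (* [d] is the distance from [x] to the next multiple of [1 / base_prod m], where the floor of
     index [m] changes. *)
  pose d := ((Num.floor ((base_prod m)%:R * x) + 1)%:~R / (base_prod m)%:R) - x.
  have d0 : 0 < d by rewrite subr_gt0 ltr_pdivlMr ?base_prodR_gt0// mulrC.
  exists (Num.min e d); first by rewrite lt_min e0.
  move=> y /andP[xy]; rewrite -ltrBlDl lt_min => /andP[yxe yxd] k.
  rewrite ltnS leq_eqVlt => /orP[/eqP ->|]; last first.
    by apply: IH; rewrite xy -ltrBlDl.
  apply: floor_def; rewrite (le_trans fx) ?ler_pM2l ?base_prodR_gt0//=.
  by move: yxd; rewrite ltrD2r ltr_pdivlMr ?base_prodR_gt0// mulrC.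
exists e => // y xye k kn; rewrite /jumps /= /digit !(eP y xye)//; lia.
Qed.

Lemma jumps0 : jumps 0 = set0.
Proof.
by rewrite -subset0 => n; apply; rewrite /digit /scaled_floor !mulr0 floor0 !mulr0.
Qed.

(** * Existence and uniqueness of expansions *)

Let digit_sum (d : nat -> nat) n : R :=
  \sum_(0 <= k < n) (d k)%:R / \prod_(i < k.+1) (a i)%:R.

Let digit_sumS d n : digit_sum d n.+1 =
  digit_sum d n + (d n)%:R / (base_prod n.+1)%:R.
Proof. by rewrite /digit_sum big_nat_recr//= /base_prod natr_prod. Qed.

Let base_prodRS n : (base_prod n.+1)%:R = (base_prod n)%:R * (a n)%:R :> R.
Proof. by rewrite base_prodS natrM. Qed.

Let base_prodR_neq0 n : (base_prod n)%:R != 0 :> R.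
Proof. by rewrite gt_eqF// base_prodR_gt0. Qed.

Let base_prod_squeeze (x y : R) :
  (forall n, `|x - y| * (base_prod n)%:R <= 1) -> x = y.
Proof.
move=> h; apply/eqP; rewrite -subr_eq0; apply/negPn/negP => xy0.
have xy : 0 < `|(x - y) / 2|.
  by rewrite normr_gt0 mulf_neq0// invr_eq0 pnatr_eq0.
have [n hn] := base_prod_small xy.
suff /(hn _ _ (leqnn n)) : `|(x - y) / 2| * (base_prod n)%:R < 1.
  by rewrite ltxx.
rewrite normrM [`|_^-1|]ger0_norm ?invr_ge0// mulrAC.
rewrite (le_lt_trans (ler_wpM2r _ (h n)))// ?invr_ge0// mul1r.
by rewrite invf_lt1// ltr1n.
Qed.

Let scaled_floor_bounds x n :
  0 <= x - (scaled_floor x n)%:~R / (base_prod n)%:R < (base_prod n)%:R^-1.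
Proof.
have /andP[fx xf] := floor_itv ((base_prod n)%:R * x).
rewrite subr_ge0 ler_pdivrMr ?base_prodR_gt0// mulrC fx/=.
rewrite ltrBlDl -[X in _ + X]mul1r -mulrDl ltr_pdivlMr ?base_prodR_gt0//.
by rewrite mulrC; move: xf; rewrite intrD.
Qed.

Let digit_sum_digit x n : digit_sum (fun k => `|digit x k|%N) n =
  (scaled_floor x n)%:~R / (base_prod n)%:R - (Num.floor x)%:~R.
Proof.
elim: n => [|n IH].
  by rewrite /digit_sum big_nil /scaled_floor /base_prod big_ord0 mul1r divr1 subrr.
rewrite digit_sumS IH; have /andP[d0 _] := digit_bounds x n.
rewrite -[(`|_|%N)%:R]/((`|digit x n|%N)%:Z%:~R) gez0_abs// /digit.
rewrite intrD intrN intrM base_prodRS; field.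
by rewrite !pnatr_eq0 -!lt0n a_gt0 base_prod_gt0.
Qed.

Lemma digit_expansion x : expansion a x (fun n => `|digit x n|%N).
Proof.
split => [n|m|].
- by have := digit_bounds x n; lia.
- apply: contrapT => h.
  have hd n : (m <= n)%N -> digit x n = (a n)%:Z - 1.
    move=> mn; have : `|digit x n|%N = (a n).-1.
      by apply: contrapT => ?; apply: h; exists n.
    by have := digit_bounds x n; have := a_gt0 n; lia.
  (* [c n] is the right end of the interval of length [1 / base_prod n] containing [x]. If all
     digits from [m] on were maximal, it would stop moving and hence equal [x], which lies strictly
     to its left. *)
  pose c n : R := ((scaled_floor x n)%:~R + 1) / (base_prod n)%:R.
  have cE n : (m <= n)%N -> c n = c m.
    move=> /subnK <-; elim: (n - m)%N => // k IH.
    rewrite addSn -IH /c; have := hd _ (leq_addl k m).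
    move: (k + m)%N => {}n /eqP; rewrite /digit subr_eq => /eqP ->.
    rewrite intrD intrD intrN intrM base_prodRS; field.
    by rewrite !pnatr_eq0 -!lt0n a_gt0 base_prod_gt0.
  have cx n : (m <= n)%N -> 0 < c m - x <= (base_prod n)%:R^-1.
    move=> mn; rewrite -(cE _ mn) /c; have := scaled_floor_bounds x n.
    rewrite mulrDl mul1r; set u := _ / _; set v := _^-1; lra.
  suff : c m = x.
    by move=> cmx; have := cx _ (leqnn m); rewrite cmx subrr ltxx.
  apply: base_prod_squeeze => n.
  have /andP[h1 h2] := cx _ (leq_maxl m n).
  rewrite gtr0_norm// (le_trans (ler_wpM2r _ h2))//.
  rewrite mulrC ler_pdivrMr ?base_prodR_gt0// mul1r ler_nat.
  by rewrite leq_base_prod// leq_maxr.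
- rewrite (eq_cvg _ _ (digit_sum_digit x)).
  apply: cvgB; last exact: cvg_cst.
  apply/cvgrPdist_lt => e e0.
  have [N hN] := base_prod_small e0.
  exists N => // n /= Nn; apply: (hN _ _ Nn).
  have /andP[h1 h2] := scaled_floor_bounds x n.
  by rewrite ger0_norm// -ltr_pdivlMr ?base_prodR_gt0// mul1r.
Qed.

(** The partial sums bound the fractional part from below. Adding [1 / base_prod n] to them gives a
    decreasing bound from above, which is strict because infinitely many digits are not maximal.
    This pins down every [scaled_floor x n], and with them the digits. *)
Lemma expansion_digit x d : expansion a x d -> forall n, (d n)%:Z = digit x n.
Proof.
move=> [d_lt d_inf d_cvg].
pose f := x - (Num.floor x)%:~R.
pose T n := digit_sum d n + (base_prod n)%:R^-1.
have TE n : T n.+1 = T n - ((a n)%:R - 1 - (d n)%:R) / (base_prod n.+1)%:R.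
  rewrite /T digit_sumS base_prodRS; field.
  by rewrite !pnatr_eq0 -!lt0n a_gt0 base_prod_gt0.
have d_le n : (d n)%:R <= (a n)%:R - 1 :> R.
  by rewrite lerBrDr natr1 ler_nat.
have T_le m n : (m <= n)%N -> T n <= T m.
  move=> /subnK <-; elim: (n - m)%N => // k IH.
  rewrite addSn TE (le_trans _ IH)// gerBl divr_ge0// subr_ge0; exact: d_le.
have S_le m n : (m <= n)%N -> digit_sum d m <= digit_sum d n.
  move=> /subnK <-; elim: (n - m)%N => // k IH.
  by rewrite addSn digit_sumS (le_trans IH)// lerDl divr_ge0.
have Sf n : digit_sum d n <= f.
  apply: cvgr_to_ge d_cvg _; exists n => // m /= nm.
  exact: S_le.
have fT n : f <= T n.
  apply: cvgr_to_le d_cvg _; exists n => // m /= nm.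
  by rewrite (le_trans _ (T_le _ _ nm))// lerDl.
have fT' n : f < T n.
  have [k nk dk] := d_inf n.
  apply: lt_le_trans (T_le _ _ nk); apply: le_lt_trans (fT k.+1) _.
  rewrite TE gtrBl divr_gt0 ?base_prodR_gt0// subr_gt0 ltrBrDr natr1 ltr_nat.
  by have := d_lt k; lia.
(* [q n] is the integer numerator of the [n]-th partial sum over the denominator [base_prod n]. *)
pose q n := (\sum_(0 <= k < n) d k * \prod_(k.+1 <= i < n) a i)%N.
have qS n : q n.+1 = (q n * a n + d n)%N.
  rewrite /q big_nat_recr//= [in X in (_ + X)%N]big_geq// muln1 big_distrl/=.
  congr addn.
  rewrite big_nat [RHS]big_nat; apply: eq_bigr => i /andP[_ ni].
  by rewrite big_nat_recr//= mulnA.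
have Sq n : digit_sum d n = (q n)%:R / (base_prod n)%:R.
  elim: n => [|n IH]; first by rewrite /digit_sum /q !big_nil mul0r.
  rewrite digit_sumS IH qS base_prodRS natrD natrM; field.
  by rewrite !pnatr_eq0 -!lt0n a_gt0 base_prod_gt0.
have qf n : scaled_floor x n = (q n)%:Z + (base_prod n)%:Z * Num.floor x.
  apply: floor_def; rewrite !intrD intrM.
  have := Sf n; have := fT' n.
  rewrite /T Sq -[X in _ + X]mul1r -mulrDl ltr_pdivlMr ?base_prodR_gt0//.
  rewrite ler_pdivrMr ?base_prodR_gt0// /f mulrC.
  rewrite -[(Posz (q n))%:~R]/((q n)%:R : R).
  rewrite -[(Posz (base_prod n))%:~R]/((base_prod n)%:R : R) mulrBr; lra.
move=> n; rewrite /digit !qf qS base_prodS !PoszD !PoszM; ring.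
Qed.

(** The expansion concerns [x] minus its floor, so the identity covers both signs. *)
Lemma jsetE x : jset a x = jumps x.
Proof.
have /expansion_digit dE : expansion a x (digits a x).
  by apply: xgetPex; exists (fun n => `|digit x n|%N); exact: digit_expansion.
apply/seteqP; split=> n /=; rewrite /jumps /jset /= -!dE.
  by move=> h [].
by move=> h h'; apply: h; rewrite h'.
Qed.

End Digits.

(** * Lower semicontinuous submeasures *)

Lemma invS_lt (R : realType) (e : R) : 0 < e -> exists n, n.+1%:R^-1 < e.
Proof.
move=> e0; exists (Num.bound e^-1).
rewrite invf_plt ?posrE// (lt_trans (archi_boundP _)) ?ltr_nat//.
by rewrite invr_ge0 ltW.
Qed.

(** Otherwise points agreeing with [x] on longer and longer initial segments would stay outside [V]
    while converging to [x]. *)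
Lemma cantor_nbhs (x : cantor_space) (V : set cantor_space) : nbhs x V ->
  exists n, forall y : cantor_space, (forall k, (k < n)%N -> y k = x k) -> V y.
Proof.
move=> xV; apply: contrapT => /forallNP noV.
have /choice[y yP] n : exists y : cantor_space,
    (forall k, (k < n)%N -> y k = x k) /\ ~ V y.
  by move/existsNP: (noV n) => [y /not_implyP]; exists y.
suff : y @ \oo --> x by move=> /(_ V xV)[n _ /(_ n (leqnn n))]; case: (yP n).
apply/(@pointwise_cvgP nat bool) => k; apply: cvg_near_cst.
by exists k.+1 => // n /= kn; have [-> ] := yP n.
Qed.

Section Submeasure.
Variables (R : realType) (phi : set nat -> \bar R).
Hypothesis phi_lsc : lsc_submeasure phi.

Let phi_ge0 := submeasure_ge0 phi_lsc.
Let phi_mono := submeasure_mono phi_lsc.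
Let phi_setU := submeasure_setU phi_lsc.

(** The sets [y] converge to [x] in the Cantor space, where lower semicontinuity makes sublevel sets
    closed. *)
Lemma submeasure_closed (x : set nat) (c : R) :
  (forall n, exists2 y, (phi y <= c%:E)%E & forall k, (k < n)%N -> y k <-> x k) ->
  (phi x <= c%:E)%E.
Proof.
move=> h; rewrite leNgt; apply/negP => cx.
pose code (z : set nat) : cantor_space := fun k => `[< z k >].
have codeK z : subset_of (code z) = z.
  by apply/seteqP; split => k /=; rewrite /subset_of /= asboolE.
have [|V xV VP] := submeasure_lsc phi_lsc (x := code x) (a := c).
  by rewrite /= codeK.
have [n nV] := cantor_nbhs xV; have [y yc yx] := h n.
have : V (code y) by apply: nV => k kn; apply: asbool_equiv_eq; exact: yx.
by move=> /VP /=; rewrite codeK ltNge yc.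
Qed.

Lemma Exh_tail (x : set nat) : Exh phi x -> forall e : R, 0 < e ->
  exists N, forall n, (N <= n)%N -> (phi (x `\` `I_n) < e%:E)%E.
Proof.
move=> /fine_cvgP[[N1 _ h1] /cvgrPdist_lt h2] e e0.
have [N2 _ {}h2] := h2 e e0.
exists (maxn N1 N2) => n; rewrite geq_max => /andP[/h1 n1 /h2 /=].
by rewrite sub0r normrN ger0_norm ?fine_ge0// -lte_fin fineK.
Qed.

Lemma ExhP (x : set nat) : Exh phi x <->
  forall e : R, 0 < e -> exists n, (phi (x `\` `I_n) <= e%:E)%E.
Proof.
split=> [/Exh_tail h e /h[n /(_ n (leqnn n))/ltW]|h]; first by exists n.
have tail m n : (m <= n)%N -> (phi (x `\` `I_n) <= phi (x `\` `I_m))%E.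
  move=> mn; apply: phi_mono; apply: setDS => k /= km.
  exact: leq_trans mn.
apply/fine_cvgP; split.
  have [N hN] := h 1 ltr01; exists N => // n /= /tail /le_lt_trans.
  by rewrite ge0_fin_numE//; apply; rewrite (le_lt_trans hN)// ltry.
apply/cvgrPdist_le => e e0; have [N hN] := h e e0.
exists N => // n /= /tail Nn; rewrite sub0r normrN ger0_norm ?fine_ge0//.
rewrite -lee_fin fineK ?(le_trans Nn)//.
by rewrite ge0_fin_numE// (le_lt_trans Nn)// (le_lt_trans hN)// ltry.
Qed.

Hypothesis Exh0 : Exh phi set0.

Lemma submeasure0 : phi set0 = 0%E.
Proof.
apply/eqP; rewrite eq_le phi_ge0 andbT; apply/lee_addgt0Pr => e e0.
rewrite add0e; have /ExhP/(_ e e0)[n] := Exh0.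
by rewrite set0D.
Qed.

(* If [T] failed to be continuous at the empty set, then gluing finite sets
   [y k] of size [phi (y k) < 2 ^ - k] with large [phi (T (y k))] would give a
   member of [Exh phi] that [T] maps outside [Exh phi]. *)
Lemma Exh_continuous0 (T : set nat -> set nat) :
  {homo T : x y / x `<=` y} -> T set0 = set0 ->
  (forall x n, T x `&` `I_n `<=` T (x `&` `I_n.+1)) ->
  (forall x, Exh phi x -> Exh phi (T x)) ->
  forall e : R, 0 < e -> exists2 d : R, 0 < d &
    forall x, (phi x < d%:E)%E -> (phi (T x) <= e%:E)%E.
Proof.
move=> T_mono T0 T_local T_Exh e e0; apply: contrapT => noe.
pose w k : R := (2 ^+ k)^-1.
have w_gt0 k : 0 < w k by rewrite invr_gt0 exprn_gt0.
have wS k : w k = 2 * w k.+1 by rewrite /w exprS invfM mulrA divff// mul1r.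
have w_small (c : R) : 0 < c -> exists K, forall k, (K <= k)%N -> w k < c.
  move=> c0; exists (Num.bound c^-1) => k Kk.
  rewrite invf_plt ?posrE ?exprn_gt0// (lt_trans (archi_boundP _))//.
    by rewrite invr_ge0 ltW.
  by rewrite -natrX ltr_nat (leq_ltn_trans Kk)// ltn_expl.
(* Finite witnesses exist: if every finite truncation of [x] had an image of submeasure at most [e],
   then by locality so would every truncation of [T x], hence [T x] itself. *)
have /choice[y yP] k : exists z : set nat,
    [/\ exists n, z `<=` `I_n, (phi z < (w k)%:E)%E & (e%:E < phi (T z))%E].
  apply: contrapT => noy; apply: noe.
  exists (w k) => // x xw; apply: submeasure_closed => n.
  exists (T x `&` `I_n) => [|j jn]; last by split=> [[]|].
  rewrite leNgt; apply/negP => ex; apply: noy.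
  exists (x `&` `I_n.+1); split.
  - by exists n.+1 => j [].
  - by apply: le_lt_trans (phi_mono _) xw => j [].
  - by apply: lt_le_trans ex (phi_mono _); exact: T_local.
(* Singletons have positive submeasure, so a set of small enough submeasure cannot contain any given
   point. *)
have y_far n : exists K, forall k, (K <= k)%N -> y k `&` `I_n = set0.
  elim: n => [|n [K1 hK1]].
    by exists 0%N => k _; rewrite II0 setI0.
  have := submeasure_set1 phi_lsc n.
  case En : (phi [set n]) => [r| |]; rewrite ?ltxx ?andbF// => /andP[r0 _].
  have [K2 hK2] := w_small r r0.
  exists (maxn K1 K2) => k; rewrite geq_max => /andP[/hK1 h1 /hK2 h2].
  rewrite -subset0 => j [yj /=]; rewrite ltnS leq_eqVlt => /orP[/eqP jn|jn].
    have [_ + _] := yP k; rewrite ltNge => /negP; apply.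
    rewrite (le_trans (ltW _) (phi_mono (x := [set n]) _))//.
      by rewrite En lte_fin.
    by move=> _ ->; rewrite -jn.
  by suff : set0 j by []; rewrite -h1.
pose u := \bigcup_k y k.
(* The bound is the geometric sum of the [w k] for [K <= k < K + j]. *)
have sum_w K j : (phi [set t | exists2 k, (K <= k < K + j)%N & y k t] <=
    (2 * w K - 2 * w (K + j)%N)%:E)%E.
  elim: j => [|j IH].
    rewrite addn0 subrr (_ : [set _ | _] = set0) ?submeasure0//.
    by rewrite -subset0 => t [k]; lia.
  apply: (@le_trans _ _ (phi ([set t | exists2 k, (K <= k < K + j)%N & y k t]
      `|` y (K + j)%N))).
    apply: phi_mono => t [k kj].
    have [->|kKj yt] := eqVneq k (K + j)%N; first by right.
    by left; exists k => //; lia.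
  apply: le_trans (phi_setU _ _) _; have [_ /ltW yw _] := yP (K + j)%N.
  apply: le_trans (leeD IH yw) _; rewrite -EFinD lee_fin addnS.
  by have := wS (K + j)%N; lra.
have u_Exh : Exh phi u.
  apply/ExhP => c c0.
  have [K hK] := w_small (c / 2) (divr_gt0 c0 (ltr0Sn R 1)).
  have [n nP] : exists n, forall k, (k < K)%N -> y k `<=` `I_n.
    elim: (K) => [|K' [n1 IH]]; first by exists 0%N.
    have [[n2 hn2] _ _] := yP K'.
    exists (maxn n1 n2) => k; rewrite ltnS leq_eqVlt => /orP[/eqP -> t|kK t].
      by move=> /hn2 /=; lia.
    by move=> /(IH k kK) /=; lia.
  (* Beyond [n] only the [y k] with [K <= k] contribute, and below [m] only finitely many of these,
     so finite subadditivity suffices. *)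
  exists n; apply: submeasure_closed => m.
  exists ((u `\` `I_n) `&` `I_m) => [|j jm]; last by split=> [[]|].
  have [M hM] := y_far m.
  apply: le_trans (le_trans (sum_w K M) _).
    apply: phi_mono => t [[[k _ yt] tn] tm]; exists k => //.
    apply/andP; split; rewrite leqNgt; apply/negP => hk.
      exact/tn/(nP k).
    by suff : set0 t by []; rewrite -(hM k); [split | lia].
  rewrite lee_fin; have := hK K (leqnn K); have := w_gt0 (K + M)%N.
  by rewrite ltr_pdivlMr//; lra.
(* A late [y K] misses [I_m.+1], so by locality [T (y K)] misses [I_m]. Its submeasure, larger than
   [e], is then carried by the tail of [T u] beyond [m]. *)
have /ExhP/(_ _ e0)[m hm] := T_Exh _ u_Exh.
have [K hK] := y_far m.+1.
have [_ _] := yP K; rewrite ltNge => /negP; apply.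
apply: le_trans hm; apply: phi_mono => t Tt; split.
  by apply: T_mono Tt => j yj; exists K.
move=> /= tm; have := T_local (y K) m t (conj Tt tm).
by rewrite hK// T0.
Qed.

End Submeasure.

(** * Smallness in the module *)

Section IdealEstimates.
Variables (R : realType) (a : nat -> nat) (phi : set nat -> \bar R).
Hypothesis phi_lsc : lsc_submeasure phi.
Hypothesis Exh_ideal : ideal (Exh phi).
Hypothesis Exh_shift : translation_invariant (Exh phi).
Hypothesis a_ge2 : base_sequence a.
Hypothesis a_adapted : adapted a (Exh phi).
Local Notation J := (jumps a).
Local Notation A := (base_jumps a).
Implicit Types (x y z : R).

Let phi_mono := submeasure_mono phi_lsc.
Let phi_setU := submeasure_setU phi_lsc.

(* A jump of [a] causes a jump in the digits of [-x] for every small [x > 0];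
   removing [A] makes smallness invariant under [x |-> -x]. *)
Definition small (e : R) x := (phi (J x `\` A) < e%:E)%E /\ `|x| < e.

Definition in_module x := Exh phi (J x).

Definition lookback (B : set nat) : set nat := B `|` succn @` B.

Let Exh_sub (x y : set nat) : x `<=` y -> Exh phi y -> Exh phi x.
Proof. exact: ideal_sub. Qed.

Let Exh_setU (x y : set nat) : Exh phi x -> Exh phi y -> Exh phi (x `|` y).
Proof. exact: ideal_setU. Qed.

Let Exh0 : Exh phi set0.
Proof. by have [x] := ideal_nonempty Exh_ideal; apply: Exh_sub. Qed.

Let Exh_In n : Exh phi `I_n.
Proof.
elim: n => [|n IH]; first by rewrite II0.
by rewrite IIS; apply: Exh_setU => //; exact: ideal_set1.
Qed.

Lemma Exh_lookahead (B : set nat) : Exh phi B -> Exh phi (lookahead B).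
Proof. by move=> EB; apply: Exh_setU => //; have [] := Exh_shift EB. Qed.

Lemma Exh_lookback (B : set nat) : Exh phi B -> Exh phi (lookback B).
Proof. by move=> EB; apply: Exh_setU => //; have [] := Exh_shift EB. Qed.

Lemma lookahead_continuous0 (e : R) : 0 < e -> exists2 d : R, 0 < d &
  forall X : set nat, (phi X < d%:E)%E -> (phi (lookahead X) <= e%:E)%E.
Proof.
apply: Exh_continuous0 => //.
- by move=> X Y; exact: lookahead_mono.
- by rewrite /lookahead preimage_set0 setU0.
- move=> X n k [[Xk|Xk] /= kn]; [left|right]; split => //=; exact: leqW.
- exact: Exh_lookahead.
Qed.

Lemma lookback_continuous0 (e : R) : 0 < e -> exists2 d : R, 0 < d &
  forall X : set nat, (phi X < d%:E)%E -> (phi (lookback X) <= e%:E)%E.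
Proof.
apply: Exh_continuous0 => //.
- by move=> X Y XY k [/XY|[j /XY Yj <-]]; [left|right; exists j].
- by rewrite /lookback image_set0 setU0.
- move=> X n k [[Xk|[j Xj <-]] /= kn]; first by left; split => //=; exact: leqW.
  by right; exists j => //; split => //=; lia.
- exact: Exh_lookback.
Qed.

Let phi_setU_lt (X Y : set nat) (c d e : R) : (phi X < c%:E)%E ->
  (phi Y < d%:E)%E -> c + d <= e -> (phi (X `|` Y) < e%:E)%E.
Proof.
move=> Xc Yd cde; apply: le_lt_trans (phi_setU _ _) _.
by apply: lt_le_trans (lteD Xc Yd) _; rewrite -EFinD lee_fin.
Qed.

(** The common estimate behind differences, quotients and separability. A tiny [z] has no jump below
    [n] outside [A]. Its later jumps outside [A] come from shifts of [X], small by continuity at the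
    empty set, or from shifts of [A] beyond [n], small because [A] is in the ideal. The two
    alternatives match [jumps_sub] and [jumps_div]. *)
Lemma jumps_tail (e : R) : 0 < e -> exists2 d : R, 0 < d & exists N,
  forall n (X : set nat) z, (N <= n)%N -> (phi X < d%:E)%E ->
    `|z| * (base_prod a n.+1)%:R < 1 ->
    J z `<=` lookahead (X `|` A `|` `I_n) \/
      J z `<=` lookback (X `|` A) `|` `I_n ->
    (phi (J z `\` A) < e%:E)%E.
Proof.
move=> e0; have e4 : 0 < e / 4 by rewrite divr_gt0.
have e2 : 0 < e / 2 by rewrite divr_gt0.
have [d1 d1_gt0 d1P] := lookahead_continuous0 e4.
have [d2 d2_gt0 d2P] := lookback_continuous0 e4.
have EA : Exh phi (lookahead A `|` lookback A).
  apply: Exh_setU; [exact: Exh_lookahead | exact: Exh_lookback].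
have [N hN] := Exh_tail phi_lsc EA e2.
exists (Num.min d1 d2); first by rewrite lt_min d1_gt0.
exists N => n X z /hN An Xd zn Jz.
have far k : (J z `\` A) k -> ~ `I_n k.
  by move=> [Jk Ak] kn; apply: Ak; apply: (jumps_small a_ge2 zn).
have [X1 X2] : (phi X < d1%:E)%E /\ (phi X < d2%:E)%E.
  by split; apply: lt_le_trans Xd _; rewrite lee_fin ge_min lexx ?orbT.
have lt4 (Y : set nat) : (phi Y <= (e / 4)%:E)%E -> (phi Y < (e / 2)%:E)%E.
  by move=> /le_lt_trans; apply; rewrite lte_fin; lra.
case: Jz => Jz.
- apply: le_lt_trans (phi_setU_lt (lt4 _ (d1P _ X1)) An _); last by lra.
  apply: phi_mono => k zk; have nk := far k zk; case: zk => /Jz + Ak.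
  move=> [[[Xk|//]|//]|[[Xk|Ak']|kn]].
  + by left; left.
  + by left; right.
  + by right; split => //; left; right.
  + by case: nk; exact: ltnW.
- apply: le_lt_trans (phi_setU_lt (lt4 _ (d2P _ X2)) An _); last by lra.
  apply: phi_mono => k zk; have nk := far k zk; case: zk => /Jz + Ak.
  move=> [[[Xk|//]|[j [Xj|Aj] jk]]|//].
  + by left; left.
  + by left; right; exists j.
  + by right; split => //; right; right; exists j.
Qed.

Let base_prodV_gt0 n : 0 < (base_prod a n)%:R^-1 :> R.
Proof. by rewrite invr_gt0 base_prodR_gt0. Qed.

(** * The sets [small e] as neighbourhoods of zero *)

Lemma smallW d e x : d <= e -> small d x -> small e x.
Proof.
move=> de [xd1 xd2]; split; last exact: lt_le_trans de.
by apply: lt_le_trans xd1 _; rewrite lee_fin.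
Qed.

Lemma small0 e : 0 < e -> small e 0.
Proof.
by move=> e0; split; rewrite ?normr0// jumps0 set0D submeasure0.
Qed.

Lemma small_eq0 x : (forall e, 0 < e -> small e x) -> x = 0.
Proof.
move=> h; apply/eqP; rewrite -normr_eq0 eq_le normr_ge0 andbT.
by apply/ler_addgt0Pr => e /h[_ /ltW]; rewrite add0r.
Qed.

Lemma small_sub e : 0 < e -> exists2 d : R, 0 < d &
  forall x y, small d x -> small d y -> small e (x - y).
Proof.
move=> e0; have [d1 d1_gt0 [N hN]] := jumps_tail e0.
(* The three bounds serve the submeasure, the absolute value, and the condition of [jumps_tail] that
   the difference be below [1 / base_prod a N.+1]; each is halved because two terms add up. *)
pose c := Num.min (d1 / 2) (Num.min (e / 2) ((base_prod a N.+1)%:R^-1 / 2)).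
exists c; first by rewrite !lt_min !divr_gt0.
move=> x y; have [cd ce cN] : [/\ c <= d1 / 2, c <= e / 2 &
    c <= (base_prod a N.+1)%:R^-1 / 2].
  by rewrite /c; split; rewrite !ge_min lexx ?orbT.
move=> [x1 x2] [y1 y2]; have xy : `|x - y| < c + c.
  by rewrite (le_lt_trans (ler_normB _ _))// ltrD.
split; last by apply: lt_le_trans xy _; lra.
apply: (hN N ((J x `\` A) `|` (J y `\` A))) => //.
- by apply: (phi_setU_lt x1 y1); lra.
- rewrite -ltr_pdivlMr ?base_prodR_gt0// mul1r; apply: lt_le_trans xy _.
  by move: cN; set u := _^-1; lra.
- left; apply: subset_trans (@jumps_sub _ _ a_ge2 _ _) _.
  apply: lookahead_mono => k Bk; left.
  have [Ak|Ak] := pselect (A k); first by right.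
  by case: Bk => [[xk|yk]|//]; left; [left|right].
Qed.

Lemma small_opp e : 0 < e -> exists2 d : R, 0 < d &
  forall x, small d x -> small e (- x).
Proof.
move=> /small_sub[d d0 dP]; exists d => // x xd.
by rewrite -[- x]add0r; apply: dP => //; exact: small0.
Qed.

Lemma in_module_sub x y : in_module x -> in_module y -> in_module (x - y).
Proof.
move=> Ex Ey; apply: Exh_sub (@jumps_sub _ _ a_ge2 _ _) _; apply: Exh_lookahead.
by apply: Exh_setU => //; exact: Exh_setU.
Qed.

Lemma in_module0 : in_module 0.
Proof. by rewrite /in_module jumps0. Qed.

Lemma in_module_opp x : in_module x -> in_module (- x).
Proof. by rewrite -[- x]add0r; apply: in_module_sub; exact: in_module0. Qed.

Lemma in_module_div (p : nat) x : pr a p -> in_module x -> in_module (x / p%:R).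
Proof.
move=> [pp [N _ hN]] Ex.
apply: Exh_sub (@jumps_div _ _ _ _ _ (prime_gt0 pp) hN) _.
by apply: Exh_setU => //; apply: Exh_lookback; exact: Exh_setU.
Qed.

Lemma small_div (p : nat) e : pr a p -> 0 < e -> exists2 d : R, 0 < d &
  forall x, small d x -> small e (x / p%:R).
Proof.
move=> [pp [M _ hM]] e0; have [d1 d1_gt0 [N hN]] := jumps_tail e0.
(* [jumps_div] says nothing about jumps below [M.+1], so the cut is placed at or after that
   index. *)
pose n := maxn N M.+1; pose u : R := (base_prod a n.+1)%:R^-1.
pose c := Num.min d1 (Num.min e u).
exists c; first by rewrite !lt_min d1_gt0 e0 /= base_prodV_gt0.
move=> x; have [cd ce cN] : [/\ c <= d1, c <= e & c <= u].
  by rewrite /c; split; rewrite !ge_min lexx ?orbT.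
move=> [x1 x2]; have xp : `|x / p%:R| < c.
  apply: le_lt_trans x2; rewrite normrM normfV normr_nat ler_pdivrMr.
    by rewrite ler_peMr// ler1n prime_gt0.
  by rewrite ltr0n prime_gt0.
split; last exact: lt_le_trans ce.
apply: (hN n (J x `\` A)).
- exact: leq_maxl.
- by apply: lt_le_trans x1 _; rewrite lee_fin.
- rewrite -ltr_pdivlMr ?base_prodR_gt0// mul1r; exact: lt_le_trans cN.
- have JA : J x `|` A `<=` (J x `\` A) `|` A.
    by move=> k Bk; have [Ak|Ak] := pselect (A k); [right|case: Bk; left].
  right; apply: subset_trans (@jumps_div _ _ _ _ _ (prime_gt0 pp) hM) _.
  move=> k [kM|[/JA Bk|[j /JA Bj jk]]].
  + by right; apply: leq_trans kM _; exact: leq_maxr.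
  + by left; left.
  + by left; right; exists j.
Qed.

(** With [rho_of_small], this identifies the topology of the sets [small e] with the submeasure
    topology. Since [rho] sees only the absolute value, negative [x] go through [small_opp]. *)
Lemma small_of_rho e : 0 < e -> exists2 d : R, 0 < d &
  forall x, (phi (J `|x|) + `|x|%:E < d%:E)%E -> small e x.
Proof.
move=> e0; have [d d_gt0 dP] := small_opp e0.
exists (Num.min d e) => [|x xd]; first by rewrite lt_min d_gt0.
have : small (Num.min d e) `|x|.
  split.
    apply: le_lt_trans xd; apply: (@le_trans _ _ (phi (J `|x|))).
      by apply: phi_mono => k [].
    by rewrite leeDl// lee_fin.
  rewrite normr_id -lte_fin; apply: le_lt_trans xd.
  by rewrite leeDr// submeasure_ge0.
have [x0|x0] := leP 0 x.
  by rewrite ger0_norm//; apply: smallW; rewrite ge_min lexx orbT.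
rewrite ltr0_norm// -{2}[x]opprK => xs; apply: dP.
by apply: smallW xs; rewrite ge_min lexx.
Qed.

(** The jumps in [A], which [small] discards, have to be put back. Those of a tiny nonnegative
    number all lie beyond [N], where [A] has small submeasure. *)
Lemma rho_of_small e : 0 < e -> exists2 d : R, 0 < d &
  forall x, small d x -> (phi (J `|x|) + `|x|%:E < e%:E)%E.
Proof.
move=> e0; have e3 : 0 < e / 3 by rewrite divr_gt0.
have [N hN] := Exh_tail phi_lsc a_adapted e3.
pose u : R := (base_prod a N.+1)%:R^-1.
pose c := Num.min (e / 3) u; have c0 : 0 < c by rewrite lt_min e3 base_prodV_gt0.
have [ce cu] : c <= e / 3 /\ c <= u.
  by rewrite /c; split; rewrite !ge_min lexx ?orbT.
have [d d_gt0 dP] := small_opp c0.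
exists (Num.min c d) => [|x xs]; first by rewrite lt_min c0.
have [x1 x2] : small c `|x|.
  have [x0|x0] := leP 0 x.
    by rewrite ger0_norm//; apply: smallW xs; rewrite ge_min lexx.
  rewrite ltr0_norm//; apply: dP.
  by apply: smallW xs; rewrite ge_min lexx orbT.
rewrite normr_id in x2.
have Jx : (phi (J `|x|) < (c + e / 3)%:E)%E.
  apply: le_lt_trans (phi_setU_lt x1 (hN N (leqnn N)) (lexx _)).
  apply: phi_mono => k xk; have [Ak|Ak] := pselect (A k); last by left.
  right; split => // kN.
  have := @jumps_small_ge0 R a a_ge2 `|x| N (normr_ge0 _) _ k (conj xk kN).
  apply; rewrite -ltr_pdivlMr ?base_prodR_gt0// mul1r.
  exact: lt_le_trans cu.
rewrite -lte_fin in x2; apply: lt_le_trans (lteD Jx x2) _.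
by rewrite -EFinD lee_fin; lra.
Qed.

(** As [v m] approaches [x] from the right, its jumps agree with those of [x] on longer and longer
    initial segments, so lower semicontinuity applies. *)
Let jumps_closed x (v : nat -> R) (c : R) :
  (forall e, 0 < e -> exists2 m, x <= v m < x + e &
    (phi (J (v m) `\` A) <= c%:E)%E) ->
  (phi (J x `\` A) <= c%:E)%E.
Proof.
move=> h; apply: submeasure_closed => // n.
have [e e0 eP] := jumps_right_continuous a_ge2 x n.
have [m xv vc] := h e e0; exists (J (v m) `\` A) => // k kn.
by split=> [] [Jk Ak]; split => //; apply/(eP _ xv k kn).
Qed.

Lemma small_complete (u : nat -> R) : (forall n, in_module (u n)) ->
  (forall e, 0 < e -> exists N, forall m n,
    (N <= m)%N -> (N <= n)%N -> small e (u m - u n)) ->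
  exists2 x, in_module x & forall e, 0 < e -> exists N, forall n,
    (N <= n)%N -> small e (u n - x).
Proof.
move=> Hu cauchy_u.
have [x ux] : exists x, u @ \oo --> x.
  suff /cauchy_cvgP/cvg_ex : cauchy (u @ \oo) by [].
  apply/cauchy_ballP => e e0; have [N hN] := cauchy_u e e0.
  exists (u @` [set n | (N <= n)%N], u @` [set n | (N <= n)%N]) => /=.
    by split; exists N => // n Nn; exists n.
  by move=> [_ _] [[m Nm <-] [n Nn <-]] /=; have [] := hN _ _ Nm Nn.
have ux_small e : 0 < e -> exists N, forall m, (N <= m)%N -> `|x - u m| < e.
  by move=> e0; have /cvgrPdist_lt/(_ e e0)[N _ hN] := ux; exists N.
have lim_small e : 0 < e -> exists N, forall n, (N <= n)%N -> small e (u n - x).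
  move=> e0; have [d d_gt0 dP] := small_opp e0.
  pose c := Num.min d e; have c0 : 0 < c by rewrite lt_min d_gt0.
  have c2 : 0 < c / 2 by rewrite divr_gt0.
  have [N1 hN1] := cauchy_u _ c2; have [N2 hN2] := ux_small _ c2.
  exists (maxn N1 N2) => n; rewrite geq_max => /andP[Nn1 Nn2].
  have unx : `|x - u n| < c by apply: lt_le_trans (hN2 n Nn2) _; lra.
  have le_c (X : set nat) : (phi X <= (c / 2)%:E)%E -> (phi X < c%:E)%E.
    by move=> /le_lt_trans; apply; rewrite lte_fin; lra.
  (* If [x <= u m] for infinitely many [m], then along these [u m - u n] tends to [x - u n] from the
     right. Otherwise [u m < x] from [M] on, and [u n - u m] tends to [u n - x] from the right. *)
  have [right|/existsNP[M left]] :=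
    pselect (forall M, exists2 m, (M <= m)%N & x <= u m).
    suff xs : small d (x - u n) by rewrite -opprB; exact: dP.
    apply: (@smallW c); first by rewrite ge_min lexx.
    split => //; apply: le_c; apply: (jumps_closed (v := fun m => u m - u n)).
    move=> r r0; have [N3 hN3] := ux_small r r0.
    have [m + xm] := right (maxn N1 N3); rewrite geq_max => /andP[m1 m3].
    exists m; last by have [/ltW] := hN1 _ _ m1 Nn1.
    by have := hN3 _ m3; rewrite ltr_distlC => /andP[]; lra.
  apply: (@smallW c); first by rewrite ge_min lexx orbT.
  split; last by rewrite distrC.
  apply: le_c; apply: (jumps_closed (v := fun m => u n - u m)).
  move=> r r0; have [N3 hN3] := ux_small r r0.
  pose m := maxn (maxn N1 N3) M.
  have [m1 m3 mM] : [/\ (N1 <= m)%N, (N3 <= m)%N & (M <= m)%N].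
    by rewrite /m; split; lia.
  exists m; last by have [/ltW] := hN1 _ _ Nn1 m1.
  have : u m < x by rewrite ltNge; apply/negP => xm; apply: left; exists m.
  by have := hN3 _ m3; rewrite ltr_distlC => /andP[]; lra.
(* The limit is in the module: with [x = u n - (u n - x)], its jumps come from those of [u n] and
   [A], which have small tails, and from those of [u n - x] outside [A], which are small as a
   whole. *)
exists x => //; apply/ExhP => // e e0.
have e2 : 0 < e / 2 by rewrite divr_gt0.
have [d d_gt0 dP] := lookahead_continuous0 e2.
have [n /(_ n (leqnn n))[und _]] := lim_small d d_gt0.
have EU : Exh phi (lookahead (J (u n) `|` A)).
  by apply: Exh_lookahead; exact: Exh_setU (Hu n) a_adapted.
have /(ExhP phi_lsc)/(_ _ e2)[k hk] := EU.
exists k; rewrite [e]splitr EFinD.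
apply: le_trans (leeD (dP _ und) hk); apply: le_trans (phi_setU _ _).
apply: phi_mono => i [].
have := @jumps_sub _ _ a_ge2 (u n) (u n - x); rewrite subKr => Jx /Jx + ik.
have cases j : (J (u n) `|` J (u n - x) `|` A) j ->
    (J (u n - x) `\` A) j \/ (J (u n) `|` A) j.
  have [Aj|Aj] := pselect (A j); first by right; right.
  by move=> [[]|//]; [right; left|left].
by case=> /cases[]; [left; left|right; split => //; left
                    |left; right|right; split => //; right].
Qed.

(* Two members of the module with the same integer part of
   [base_prod a n.+1 * x] and few jumps beyond [n] are close. *)
Lemma small_separable : exists2 D : set R, countable D &
  forall x, in_module x -> forall e, 0 < e ->
    exists2 y, D y /\ in_module y & small e (y - x).
Proof.
pose cell (i : nat * nat * int) : set R := [set y | [/\ in_module y,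
  scaled_floor a y i.1.1.+1 = i.2 &
  (phi ((J y `\` A) `\` `I_i.1.1) < (i.1.2.+1%:R^-1)%:E)%E]].
(* One point is chosen per cell. The default 0 for an empty cell is harmless, since only cells
   containing some [x] are consulted. *)
exists (range (fun i => xget 0 (cell i)));
  first exact: card_le_trans (card_image_le _ _) (countableP _).
move=> x Ex e e0; have [d1 d1_gt0 [N1 hN1]] := jumps_tail e0.
have [m mP] : exists m, m.+1%:R^-1 < d1 / 2 by apply: invS_lt; rewrite divr_gt0.
have EJ : Exh phi (J x `\` A) by apply: Exh_sub Ex => k [].
have [|N2 hN2] := Exh_tail phi_lsc EJ (e := m.+1%:R^-1); first by rewrite invr_gt0.
have [N3 hN3] := base_prod_small a_ge2 e0.
pose n := maxn (maxn N1 N2) N3.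
have [n1 n2 n3] : [/\ (N1 <= n)%N, (N2 <= n)%N & (N3 <= n)%N].
  by rewrite /n; split; lia.
pose i := (n, m, scaled_floor a x n.+1).
have cx : cell i x by split => //; exact: hN2.
have [Ey yx yn] : cell i (xget 0 (cell i)) by apply: xgetPex; exists x.
set y := xget 0 (cell i) in Ey yx yn *; exists y => [|].
  by split => //; exists i.
have xyn : `|y - x| * (base_prod a n.+1)%:R < 1.
  have := floor_itv ((base_prod a n.+1)%:R * y).
  have := floor_itv ((base_prod a n.+1)%:R * x).
  rewrite -!/(scaled_floor a _ n.+1) yx /= intrD mulr1z => /andP[x1 x2] /andP[y1 y2].
  rewrite -[X in _ * X]ger0_norm// -normrM ltr_norml mulrBl.
  rewrite [y * _]mulrC [x * _]mulrC; apply/andP; split; lra.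
split; last by apply: hN3 xyn; exact: leqW.
apply: (hN1 n (((J y `\` A) `\` `I_n) `|` ((J x `\` A) `\` `I_n))) => //.
  apply: (phi_setU_lt yn (hN2 _ n2)); rewrite /i /= [d1]splitr.
  by rewrite lerD// ltW.
left; apply: subset_trans (@jumps_sub _ _ a_ge2 _ _) _.
apply: lookahead_mono => k Bk; have [kn|kn] := pselect (`I_n k); first by right.
left; have [Ak|Ak] := pselect (A k); first by right.
by case: Bk => [[yk|xk]|//]; left; [left|right].
Qed.

(** * Multiplication by scalars *)

Definition scalable (q : rat) : Prop :=
  (forall x, in_module x -> in_module (ratr q * x)) /\
  (forall e, 0 < e -> exists2 d : R, 0 < d &
    forall x, small d x -> small e (ratr q * x)).

Let scalableB q r : scalable q -> scalable r -> scalable (q - r).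
Proof.
move=> [Hq sq] [Hr sr]; split=> [x Ex|e /small_sub[d d_gt0 dP]].
  by rewrite rmorphB mulrBl; apply: in_module_sub; [exact: Hq|exact: Hr].
have [d1 d1_gt0 d1P] := sq d d_gt0; have [d2 d2_gt0 d2P] := sr d d_gt0.
exists (Num.min d1 d2) => [|x xs]; first by rewrite lt_min d1_gt0.
rewrite rmorphB mulrBl; apply: dP; [apply: d1P|apply: d2P].
  by apply: smallW xs; rewrite ge_min lexx.
by apply: smallW xs; rewrite ge_min lexx orbT.
Qed.

Let scalableM q r : scalable q -> scalable r -> scalable (q * r).
Proof.
move=> [Hq sq] [Hr sr]; split=> [x Ex|e /sq[d d_gt0 dP]].
  by rewrite rmorphM -mulrA; apply/Hq/Hr.
have [d1 d1_gt0 d1P] := sr d d_gt0.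
exists d1 => // x /d1P/dP xs.
have -> : ratr (q * r) * x = ratr q * (ratr r * x) by rewrite rmorphM mulrA.
exact: xs.
Qed.

Let scalable1 : scalable 1.
Proof.
split=> [x|e e0]; first by rewrite rmorph1 mul1r.
by exists e => // x; rewrite rmorph1 mul1r.
Qed.

Let scalable_int (k : int) : scalable k%:~R.
Proof.
have s0 : scalable 0 by rewrite -(subrr 1); exact: scalableB.
have sn (n : nat) : scalable n%:R.
  elim: n => [//|n IH]; rewrite -natr1 -[1]opprK; apply: scalableB => //.
  by rewrite -sub0r; exact: scalableB.
case: k => n; first exact: sn.
by rewrite NegzE intrN -sub0r; apply: scalableB => //; exact: sn.
Qed.

(** Strong induction on [l], splitting off its least prime factor, reduces this to division by a
    prime in [pr a]. *)
Let scalable_inv (l : nat) : (0 < l)%N ->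
  (forall p, prime p -> (p %| l)%N -> pr a p) -> scalable l%:R^-1.
Proof.
have [n] := ubnP l; elim: n l => // n IH l ln l0 lp.
have [l1|l1] := leqP l 1.
  by rewrite (_ : l = 1%N) ?invr1//; lia.
have pp := pdiv_prime l1; have /dvdnP[m lm] := pdiv_dvd l.
have ap : pr a (pdiv l) by apply: lp => //; exact: pdiv_dvd.
rewrite lm natrM invfM; apply: scalableM.
  apply: IH; [|by move: l0; rewrite lm muln_gt0 => /andP[]|].
    by have := prime_gt1 pp; move: ln l0; rewrite {1 2}lm; nia.
  by move=> p hp pm; apply: lp => //; rewrite lm dvdn_mulr.
split=> [x Ex|e e0].
  by rewrite fmorphV rmorph_nat mulrC; exact: in_module_div.
have [d d_gt0 dP] := small_div ap e0; exists d => // x /dP.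
by rewrite fmorphV rmorph_nat mulrC.
Qed.

Lemma scalable_Qa (q : Qa a) : scalable (Qa_val q).
Proof.
have /Qa_predP[k [l [l0 lp ->]]] := Qa_valP q.
by apply: scalableM; [exact: scalable_int | exact: scalable_inv].
Qed.

End IdealEstimates.

(** * Abelian groups topologized by a countable base at zero *)

(** The single axiom on differences yields symmetry, by taking [x = 0], and then sums. *)
Record zero_base (G : zmodType) := ZeroBase {
  zbase :> nat -> set G;
  zbase0 : forall n, zbase n 0;
  zbase_mono : forall m n, (m <= n)%N -> zbase n `<=` zbase m;
  zbase_sub : forall n, exists m, forall x y,
    zbase m x -> zbase m y -> zbase n (x - y)
}.

(** The alias carries [V], so that the uniform structure can depend on the base and not only on
    [G]. *)
Definition based_group (G : zmodType) (V : zero_base G) : Type := G.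

Section BasedGroupUniform.
Variables (G : zmodType) (V : zero_base G).
Local Notation M := (based_group V).

HB.instance Definition _ := GRing.Zmodule.on M.

Definition based_entourage : set_system (M * M) :=
  [set E | exists n, forall x y : M, V n (y - x) -> E (x, y)].

Let based_entourage_filter : Filter based_entourage.
Proof.
split; first by exists 0%N.
- move=> P Q [m hP] [n hQ]; exists (maxn m n) => x y xy; split.
    by apply: hP; apply: zbase_mono xy; exact: leq_maxl.
  by apply: hQ; apply: zbase_mono xy; exact: leq_maxr.
- by move=> P Q PQ [n hP]; exists n => x y /hP/PQ.
Qed.

Local Open Scope relation_scope.

Let based_entourage_diagonal E : based_entourage E -> diagonal `<=` E.
Proof.
move=> [n hE] [x y] xy; have <- : x = y := xy.
by apply: hE; rewrite subrr; exact: zbase0.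
Qed.

Let based_entourage_inv E : based_entourage E -> based_entourage E^-1.
Proof.
move=> [n hE]; have [m hm] := zbase_sub V n.
exists m => x y xy; apply: hE; rewrite -opprB -[- _]add0r.
by apply: hm => //; exact: zbase0.
Qed.

Let based_entourage_split E : based_entourage E ->
  exists2 B, based_entourage B & B \; B `<=` E.
Proof.
move=> [n hE]; have [m hm] := zbase_sub V n; have [k hk] := zbase_sub V m.
exists [set xy | V (maxn m k) (xy.2 - xy.1)]; first by exists (maxn m k).
move=> [x z] [y /= xy yz]; apply: hE.
have -> : z - x = (y - x) - (0 - (z - y)).
  by rewrite sub0r opprK [RHS]addrC addrA subrK.
apply: hm; first by apply: zbase_mono xy; exact: leq_maxl.
apply: hk; first exact: zbase0.
by apply: zbase_mono yz; exact: leq_maxr.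
Qed.

HB.instance Definition _ := isUniform.Build M based_entourage_filter
  based_entourage_diagonal based_entourage_inv based_entourage_split.

Lemma based_nbhsP (x : M) (B : set M) :
  nbhs x B <-> exists n, forall y : M, V n (y - x) -> B y.
Proof.
rewrite nbhsE_subproof; split=> [[E [n hE] EB]|[n hB]].
  by exists n => y /hE xy; apply: EB; exact/mem_set.
exists [set xy | V n (xy.2 - xy.1)]; first by exists n.
by move=> y /set_mem /hB.
Qed.

Let based_sub_continuous : continuous (fun x : M * M => x.1 - x.2).
Proof.
move=> [x y] B /based_nbhsP[n hB]; have [m hm] := zbase_sub V n.
exists ([set u | V m (u - x)], [set u | V m (u - y)]).
  by split; apply/based_nbhsP; exists m.
move=> [u v] /= [ux vy]; apply: hB => /=.
rewrite (_ : _ - _ = (u - x) - (v - y)); first exact: hm.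
by rewrite !opprB addrACA [RHS]addrACA [in RHS](addrC (- x)).
Qed.

HB.instance Definition _ :=
  PreTopologicalNmodule_isTopologicalZmodule.Build M based_sub_continuous.

Lemma based_open (U : set M) :
  open U <-> forall x, U x -> exists n, forall y : M, V n (y - x) -> U y.
Proof.
rewrite openE; split=> h x Ux; first exact/based_nbhsP/h.
exact/based_nbhsP/h.
Qed.

Lemma based_countable_uniformity : countable_uniformity M.
Proof.
apply/countable_uniformityP; exists (fun n => [set xy | V n (xy.2 - xy.1)]).
  by move=> E [n hE]; exists n => -[x y] /hE.
by move=> n; exists n.
Qed.

End BasedGroupUniform.

Section BasedGroupPolish.
Variables (R : realType) (G : zmodType) (V : zero_base G).
Local Notation M := (based_group V).

Let T := countable_uniform (@based_countable_uniformity G V).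

(** A countable uniformity comes from a family of balls. The infimum of the radii is a distance,
    finite because any two points are within 2 of each other. *)
Let dist (x y : M) : R := fine (@edist R T (x, y)).

Let edist_fin_num (x y : T) : @edist R T (x, y) \is a fin_num.
Proof.
apply/edist_finP; exists 2 => //.
exact: countable_uniform.countable_uniform_bounded.
Qed.

Let dist_lt_ball (x y : T) (e : R) : dist x y < e -> ball x e y.
Proof.
move=> xye; apply: (@edist_lt_ball _ _ e (x, y)).
by rewrite -(fineK (edist_fin_num x y)) lte_fin.
Qed.

Let ball_dist_le (x y : T) (e : R) : 0 < e -> ball x e y -> dist x y <= e.
Proof.
move=> e0 xye; rewrite -lee_fin fineK//; exact: edist_fin.
Qed.

Let ball_base (x : T) (e : R) : 0 < e ->
  exists n, forall y : M, V n (y - x) -> ball x e y.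
Proof.
move=> e0; apply/based_nbhsP; exact: (@nbhsx_ballx R T x e).
Qed.

Let base_ball n : exists2 e : R, 0 < e &
  forall x y : T, ball x e y -> V n ((y : M) - (x : M)).
Proof.
have : entourage [set xy : T * T | V n ((xy.2 : M) - (xy.1 : M))] by exists n.
rewrite -(@entourage_ballE R T) => -[e e0 h].
by exists e => // x y /= xy; apply: (h (x, y)).
Qed.

(** The distance and the base define the same uniformity, so separation, completeness and density
    can all be tested on the base. *)
Lemma based_group_polish :
  (forall x : G, (forall n, V n x) -> x = 0) ->
  (forall u : nat -> G,
    (forall n, exists N, forall i j, (N <= i)%N -> (N <= j)%N ->
      V n (u i - u j)) ->
    exists x, forall n, exists N, forall i, (N <= i)%N -> V n (u i - x)) ->
  (exists2 D : set G, countable D &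
    forall x n, exists2 y, D y & V n (y - x)) ->
  polish_space R M.
Proof.
move=> V_sep V_complete [D D_countable D_dense]; split.
  exists D => // U [x Ux] Uopen.
  have [n hn] := (based_open U).1 Uopen x Ux.
  by have [y Dy xy] := D_dense x n; exists y; split => //; exact: hn.
exists dist; split.
- move=> x y; split=> [xy0|->].
    apply/esym/eqP; rewrite -subr_eq0; apply/eqP/V_sep => n.
    have [e e0 h] := base_ball n; apply: h.
    by apply: dist_lt_ball; rewrite xy0.
  apply/eqP; rewrite eq_le fine_ge0 ?edist_ge0// andbT.
  apply/ler_addgt0Pr => e e0; rewrite add0r; apply: ball_dist_le => //.
  exact: ballxx.
- by move=> x y; rewrite /dist edist_sym.
- move=> x y z; rewrite /dist -fineD// fine_le// ?fin_numD ?edist_fin_num//.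
  exact: edist_triangle.
- move=> x B; split=> [/based_nbhsP[n hn]|[e e0 he]].
    have [e e0 h] := base_ball n; exists e => // y /dist_lt_ball/h; exact: hn.
  have e2 : 0 < e / 2 by rewrite divr_gt0.
  have [n hn] := ball_base x e2; apply/based_nbhsP; exists n => y /hn xy.
  apply: he => /=; apply: le_lt_trans (ball_dist_le e2 xy) _.
  by rewrite ltr_pdivrMr// ltr_pMr// ltr1n.
- move=> u u_cauchy; have [x hx] : exists x, forall n, exists N, forall i,
      (N <= i)%N -> V n (u i - x).
    apply: V_complete => n; have [e e0 h] := base_ball n.
    have [N hN] := u_cauchy e e0; exists N => i j Ni Nj.
    by apply: h; apply: dist_lt_ball; exact: hN.
  exists x => B /based_nbhsP[n hn]; have [N hN] := hx n.
  by exists N => // i /= Ni; apply: hn; exact: hN.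
Qed.

End BasedGroupPolish.

Lemma based_continuous (G G' : zmodType) (V : zero_base G) (V' : zero_base G')
    (f : G -> G') : {morph f : x y / x - y} ->
  (forall n, exists m, forall x, V m x -> V' n (f x)) ->
  continuous (f : based_group V -> based_group V').
Proof.
move=> fB hf x B /based_nbhsP[n hB]; have [m hm] := hf n.
by apply/based_nbhsP; exists m => y /hm fy; apply: hB; rewrite -fB.
Qed.

(** * The module *)

Record zmod_sub (G : zmodType) (P : zmodClosed G) :=
  ZmodSub { zmod_val : G; zmod_valP : zmod_val \in P }.

HB.instance Definition _ (G : zmodType) (P : zmodClosed G) :=
  [isSub for @zmod_val G P].
HB.instance Definition _ (G : zmodType) (P : zmodClosed G) :=
  [Choice of zmod_sub P by <:].
HB.instance Definition _ (G : zmodType) (P : zmodClosed G) :=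
  [SubChoice_isSubZmodule of zmod_sub P by <:].

Section IdealModuleConstruction.
Variables (R : realType) (a : nat -> nat) (phi : set nat -> \bar R).
Hypothesis phi_lsc : lsc_submeasure phi.
Hypothesis Exh_ideal : ideal (Exh phi).
Hypothesis Exh_shift : translation_invariant (Exh phi).
Hypothesis a_ge2 : base_sequence a.
Hypothesis a_adapted : adapted a (Exh phi).

Lemma carrierE x : carrier (Exh phi) a x <-> in_module a phi x.
Proof.
have opp := in_module_opp Exh_ideal Exh_shift a_ge2 a_adapted.
split=> [[r []]|Ex].
  by rewrite jsetE// => _ Er [->|->] //; exact: opp.
have [x0|x0] := leP 0 x; [exists x | exists (- x)]; rewrite jsetE//; split => //.
- by left.
- by rewrite oppr_ge0 ltW.
- exact: opp.
- by right; rewrite opprK.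
Qed.

Let mem_module : {pred R} := fun x => `[< in_module a phi x >].

Let mem_module_closed : zmod_closed mem_module.
Proof.
split=> [|x y /asboolP Ex /asboolP Ey]; apply/asboolP.
  exact: in_module0.
exact: in_module_sub.
Qed.

Let P : zmodClosed R :=
  HB.pack mem_module (GRing.isZmodClosed.Build R mem_module mem_module_closed).

Let G : zmodType := zmod_sub P.

Let G_in (x : G) : in_module a phi (val x).
Proof. exact/asboolP/(valP x). Qed.

Let base n : set G := [set z | small a phi n.+1%:R^-1 (val z)].

Let base0 n : base n 0.
Proof. exact: small0. Qed.

Let base_mono m n : (m <= n)%N -> base n `<=` base m.
Proof. by move=> mn z; apply: smallW; rewrite lef_pV2 ?posrE// ler_nat. Qed.

Let small_le (d : R) : 0 < d ->
  exists n, forall x, small a phi n.+1%:R^-1 x -> small a phi d x.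
Proof. by move=> /invS_lt[n /ltW nd]; exists n => z; exact: smallW. Qed.

Let base_sub n : exists m, forall x y, base m x -> base m y -> base n (x - y).
Proof.
have [|d d_gt0 dP] := small_sub phi_lsc Exh_ideal Exh_shift a_ge2 a_adapted
  (e := n.+1%:R^-1); first by rewrite invr_gt0.
have [m hm] := small_le d_gt0; exists m => x y /hm xd /hm yd.
by have := dP _ _ xd yd; rewrite -raddfB.
Qed.

Let V := ZeroBase base0 base_mono base_sub.

Let M : topologicalZmodType := based_group V.

Let act_proof (q : Qa a) (x : G) : ratr (Qa_val q) * val x \in P.
Proof.
apply/asboolP.
have [h _] := scalable_Qa phi_lsc Exh_ideal Exh_shift a_ge2 a_adapted q.
exact: h (G_in x).
Qed.

Let act (q : Qa a) (x : M) : M := ZmodSub (act_proof q x).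

Let iota (x : M) : R := val (x : G).

Let iota_act q x : iota (act q x) = ratr (Qa_val q) * iota x.
Proof. by []. Qed.

Let iotaB : {morph iota : x y / x - y}.
Proof. by move=> x y; rewrite /iota raddfB. Qed.

Let iotaD : {morph iota : x y / x + y}.
Proof. by move=> x y; rewrite /iota raddfD. Qed.

Let VE n (x y : M) : V n (y - x) = small a phi n.+1%:R^-1 (iota y - iota x).
Proof. by rewrite -iotaB. Qed.

Let iota_inj : injective iota. Proof. exact: val_inj. Qed.

Let iota_onto x : in_module a phi x -> exists y : M, iota y = x.
Proof.
by move=> Ex; have xP : x \in P by [exact/asboolP]; exists (ZmodSub xP).
Qed.

Let iota_hom : module_hom act (@real_act R a) iota.
Proof. by split; [exact: iotaD | exact: iota_act]. Qed.

Let rhoE x y :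
  rho a phi x y = (phi (jumps a `|y - x|%R) + (`|y - x|%R)%:E)%E.
Proof. by rewrite /rho jsetE// distrC. Qed.

(** By [small_of_rho] and [rho_of_small], translates of the base and balls of [rho] refine each
    other around every point. *)
Let iota_open (U : set M) : open U <-> submeasure_open (Exh phi) a phi (iota @` U).
Proof.
rewrite based_open; split=> [Uopen|[_ Uopen] x Ux].
  split=> [_ [x Ux <-]|_ [x Ux <-]]; first exact/carrierE/G_in.
  have [n hn] := Uopen x Ux.
  have [|e e0 he] := small_of_rho phi_lsc Exh_ideal Exh_shift a_ge2 a_adapted
    (e := n.+1%:R^-1); first by rewrite invr_gt0.
  exists e => // _ [/carrierE/iota_onto[y <-]]; rewrite rhoE => /he xy.
  by exists y => //; apply: hn; rewrite VE.
have [e e0 he] := Uopen (iota x) (ex_intro2 _ _ x Ux erefl).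
have [d d_gt0 dP] := rho_of_small phi_lsc Exh_ideal Exh_shift a_ge2 a_adapted e0.
have [n hn] := small_le d_gt0; exists n => y; rewrite VE => /hn/dP xy.
have /he[z Uz /iota_inj <- //] : [set s | carrier (Exh phi) a s /\
    (rho a phi (iota x) s < e%:E)%E] (iota y).
  by split; [exact/carrierE/G_in | rewrite rhoE].
Qed.

Let iota_continuous : continuous iota.
Proof.
move=> x; apply/(cvgrPdist_lt (FF := nbhs_filter x)) => e e0.
have [n hn] := small_le e0.
apply/based_nbhsP; exists n => y; rewrite VE => /hn[_].
by rewrite distrC.
Qed.

Let act_continuous q : continuous (act q).
Proof.
apply: based_continuous => [x y|n].
  by apply: iota_inj; rewrite iotaB !iota_act iotaB mulrBr.
have [_ /(_ n.+1%:R^-1)[|d d_gt0 dP]] :=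
  scalable_Qa phi_lsc Exh_ideal Exh_shift a_ge2 a_adapted q.
  by rewrite invr_gt0.
by have [m hm] := small_le d_gt0; exists m => x /hm/dP.
Qed.

Let M_polish : polish_space R M.
Proof.
apply: based_group_polish.
- move=> x hx; apply: iota_inj; apply: (small_eq0 (a := a) (phi := phi)) => e.
  by move=> /small_le[n]; apply; exact: hx.
- move=> u u_cauchy.
  have [|e e0|x Ex hx] := small_complete phi_lsc Exh_ideal Exh_shift a_ge2
      a_adapted (u := iota \o u).
  + by move=> n; exact: G_in.
  + have [n hn] := small_le e0; have [N hN] := u_cauchy n.
    by exists N => i j Ni Nj; apply: hn; have := hN i j Ni Nj; rewrite VE.
  + have [y yx] := iota_onto Ex; exists y => n.
    have [|N hN] := hx n.+1%:R^-1; first by rewrite invr_gt0.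
    by exists N => i /hN; rewrite VE -yx.
- have [D D_countable D_dense] := small_separable phi_lsc Exh_ideal Exh_shift
    a_ge2 a_adapted.
  exists (iota @^-1` D).
    have /countable_injP[f f_inj] := D_countable.
    apply/countable_injP; exists (f \o iota) => x y /set_mem Dx /set_mem Dy.
    by move=> /f_inj xy; apply/iota_inj/xy; exact/mem_set.
  move=> x n; have [|y [Dy Ey] xy] := D_dense (iota x) (G_in x) n.+1%:R^-1.
    by rewrite invr_gt0.
  have [z zy] := iota_onto Ey; exists z; first by rewrite /= zy.
  by rewrite VE zy.
Qed.

Lemma ideal_module_exists :
  exists (M : topologicalZmodType) (act : Qa a -> M -> M) (iota : M -> R),
    [/\ is_ideal_module (Exh phi) phi act iota,
        polish_module R act,
        continuous iota
      & module_embedding act (@real_act R a) iota].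
Proof.
exists M, act, iota; split => //.
  split => //; apply/seteqP; split=> [_ [x _ <-]|x /carrierE/iota_onto[y <-]].
    exact/carrierE/G_in.
  by exists y.
split => //.
- by move=> k l x; apply: iota_inj; rewrite !iota_act !rmorphM mulrA.
- by move=> x; apply: iota_inj; rewrite iota_act !rmorph1 mul1r.
- by move=> k x y; apply: iota_inj; rewrite iotaD !iota_act iotaD mulrDr.
- by move=> x k l; apply: iota_inj; rewrite iotaD !iota_act !rmorphD mulrDl.
Qed.

End IdealModuleConstruction.

Theorem theorem2p13 (R : realType) (I : set (set nat)) (a : nat -> nat)
    (phi : set nat -> \bar R) :
  analytic_P_ideal R I -> translation_invariant I ->
  base_sequence a -> adapted a I ->
  lsc_submeasure phi -> I = Exh phi ->
  exists (M : topologicalZmodType) (act : Qa a -> M -> M) (iota : M -> R),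
    [/\ is_ideal_module I phi act iota,
        polish_module R act,
        continuous iota
      & module_embedding act (@real_act R a) iota].
Proof.
move=> [I_ideal _ _] I_shift a_ge2 a_adapted phi_lsc IE; subst I.
exact: ideal_module_exists.
Qed.
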